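(* Let $A\subseteq B$ be a ring extension and $I$ a common ideal of $A$ and $B$ (i.e. $I\subseteq A$ is an ideal of both $A$ and $B$). Then $A\subseteq B$ is a PSI-extension (resp. strong PSI-extension) if and only if $A/I\subseteq B/I$ is a PSI-extension (resp. strong PSI-extension).
   Context: All rings are commutative and unitary, and ring morphisms are unitary. For a ring extension $A\subseteq B$, a proper ideal $J$ of $B$ is called $A$-prime if $ab\in J$ with $a\in A$ and $b\in B$ implies that $a\in J$ or $b\in J$. The extension $A\subseteq B$ is a PSI-extension if every $A$-prime ideal of $B$ is a prime ideal of $B$. For $P\in\mathrm{Spec}(A)$, $k_A(P)=A_P/PA_P$ denotes the residue field of $A$ at $P$. The extension $A\subseteq B$ is a strong PSI-extension if for every $P\in\mathrm{Spec}(A)$ with $k_A(P)\otimes_A B\neq 0$, the canonical map $k_A(P)\to k_A(P)\otimes_A B$ is an isomorphism. *)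

(* Defs.v *)
From HB Require Import structures.
From mathcomp Require Import all_boot all_order all_algebra.
From mathcomp Require Import boolp classical_sets.
From mathcomp Require Import ring.

Set Implicit Arguments.
Unset Strict Implicit.
Unset Printing Implicit Defensive.

Import GRing.Theory.

Local Open Scope classical_set_scope.
Local Open Scope ring_scope.
Local Open Scope quotient_scope.

(* Rings are [comPzRingType]s: commutative and unitary, with the zero ring
   allowed, since A/I is the zero ring when I = A.  For the same reason the
   ideals of [ring_quotient], which are proper by definition and live in
   nontrivial rings, cannot be used. *)

Definition is_ideal (R : comPzRingType) (I : set R) : Prop :=
  [/\ I 0, (forall x y, I x -> I y -> I (x + y)) &
      (forall a x, I x -> I (a * x))].

Record ideal (R : comPzRingType) := Ideal {
  ideal_set :> R -> Prop;
  idealP : is_ideal ideal_set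
}.

Definition is_proper (R : comPzRingType) (I : ideal R) : Prop :=
  ideal_set I <> setT.

Definition prime_ideal (R : comPzRingType) (I : ideal R) : Prop :=
  is_proper I /\ forall x y : R, I (x * y) -> I x \/ I y.

Record spec (R : comPzRingType) := Spec {
  spec_ideal :> ideal R;
  spec_prime : prime_ideal spec_ideal
}.

Section IdealFacts.
Variables (R : comPzRingType) (I : ideal R).

Lemma ideal0 : I 0. Proof. by have [] := idealP I. Qed.
Lemma idealD x y : I x -> I y -> I (x + y).
Proof. by have [_ JD _] := idealP I; apply: JD. Qed.
Lemma idealMl a x : I x -> I (a * x).
Proof. by have [_ _ JM] := idealP I; apply: JM. Qed.
Lemma idealN x : I x -> I (- x).
Proof. by rewrite -mulN1r; apply: idealMl. Qed.
Lemma idealB x y : I x -> I y -> I (x - y).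
Proof. by move=> Ix Iy; apply: idealD => //; apply: idealN. Qed.

Lemma properP : is_proper I <-> ~ I 1.
Proof.
split=> [pI I1|I1 IT]; last by apply: I1; rewrite IT.
by apply: pI; rewrite -subTset => x _; rewrite -[x]mulr1; apply: idealMl.
Qed.

Definition ideal_pred : {pred R} := fun x => `[< I x >].

Lemma ideal_pred_zmod_closed : zmod_closed ideal_pred.
Proof.
split; first by apply/asboolP; apply: ideal0.
by move=> x y /asboolP Ix /asboolP Iy; apply/asboolP; apply: idealB.
Qed.

HB.instance Definition _ :=
  GRing.isZmodClosed.Build R ideal_pred ideal_pred_zmod_closed.

End IdealFacts.

(* The quotient ring R/I: the library's quotient of the additive group,
   with the induced product. *)
Section QuotientRing.
Variables (R : comPzRingType) (I : ideal R).

Definition quot_ring : Type := Quotient.quot (ideal_pred I).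
HB.instance Definition _ := GRing.Zmodule.on quot_ring.

Definition quot_proj (x : R) : quot_ring := \pi_(Quotient.quot (ideal_pred I)) x.
Definition quot_repr (u : quot_ring) : R := repr u.

Lemma quot_reprK u : quot_proj (quot_repr u) = u.
Proof. exact: reprK. Qed.

Lemma quot_projP x y : quot_proj x = quot_proj y <-> I (x - y).
Proof.
split=> [/eqP|Ixy]; first by rewrite -Quotient.idealrBE => /asboolP.
by apply/eqP; rewrite -Quotient.idealrBE; apply/asboolP.
Qed.

Lemma quot_proj_zmod : zmod_morphism quot_proj.
Proof. by move=> x y; rewrite /quot_proj raddfB. Qed.

HB.instance Definition _ :=
  GRing.isZmodMorphism.Build R quot_ring quot_proj quot_proj_zmod.

Definition quot_one : quot_ring := quot_proj 1.
Definition quot_mul (u v : quot_ring) : quot_ring :=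
  quot_proj (quot_repr u * quot_repr v).

Lemma quot_projM x y : quot_proj (x * y) = quot_mul (quot_proj x) (quot_proj y).
Proof.
have K z : I (z - quot_repr (quot_proj z)).
  by apply/quot_projP; rewrite quot_reprK.
apply/quot_projP; move: (K x) (K y).
set x' := quot_repr _; set y' := quot_repr _ => Ix Iy.
have -> : x * y - x' * y' = y * (x - x') + x' * (y - y') by ring.
by apply: idealD; apply: idealMl.
Qed.

Lemma quot_mulA : associative quot_mul.
Proof.
move=> u v w; rewrite -[u]quot_reprK -[v]quot_reprK -[w]quot_reprK.
by rewrite -!quot_projM mulrA.
Qed.
Lemma quot_mulC : commutative quot_mul.
Proof. by move=> u v; rewrite /quot_mul mulrC. Qed.
Lemma quot_mul1 : left_id quot_one quot_mul.
Proof. by move=> u; rewrite -[u]quot_reprK -quot_projM mul1r. Qed.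
Lemma quot_mulDl : left_distributive quot_mul +%R.
Proof.
move=> u v w; rewrite -[u]quot_reprK -[v]quot_reprK -[w]quot_reprK.
by rewrite -raddfD -!quot_projM -raddfD mulrDl.
Qed.

HB.instance Definition _ := GRing.Zmodule_isComPzRing.Build quot_ring
  quot_mulA quot_mulC quot_mul1 quot_mulDl.

Lemma quot_proj_monoid : monoid_morphism quot_proj.
Proof. by split=> // x y; rewrite quot_projM. Qed.

HB.instance Definition _ :=
  GRing.isMonoidMorphism.Build R quot_ring quot_proj quot_proj_monoid.

End QuotientRing.

(* For f : A -> B with f(I) included in J, the induced map A/I -> B/J. *)
Section QuotientMap.
Variables (A B : comPzRingType) (f : {rmorphism A -> B}).
Variables (I : ideal A) (J : ideal B) (fIJ : f @` I `<=` J).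

Definition quot_map of f @` I `<=` J : quot_ring I -> quot_ring J :=
  fun u => quot_proj J (f (quot_repr u)).

Lemma quot_map_proj x : quot_map fIJ (quot_proj I x) = quot_proj J (f x).
Proof.
apply/quot_projP; rewrite -rmorphB; apply: fIJ.
by exists (quot_repr (quot_proj I x) - x) => //; apply/quot_projP; rewrite quot_reprK.
Qed.

Lemma quot_map_zmod : zmod_morphism (quot_map fIJ).
Proof.
move=> u v; rewrite -[u]quot_reprK -[v]quot_reprK.
by rewrite -rmorphB !quot_map_proj !rmorphB.
Qed.
Lemma quot_map_monoid : monoid_morphism (quot_map fIJ).
Proof.
split=> [|u v]; first by rewrite -[1]/(quot_proj I 1) quot_map_proj rmorph1.
rewrite -[u]quot_reprK -[v]quot_reprK.
by rewrite -rmorphM !quot_map_proj !rmorphM.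
Qed.

HB.instance Definition _ := GRing.isZmodMorphism.Build
  (quot_ring I) (quot_ring J) (quot_map fIJ) quot_map_zmod.
HB.instance Definition _ := GRing.isMonoidMorphism.Build
  (quot_ring I) (quot_ring J) (quot_map fIJ) quot_map_monoid.

End QuotientMap.

(* The ideal of B generated by f(I). *)
Section ExtendedIdeal.
Variables (A B : comPzRingType) (f : {rmorphism A -> B}) (I : ideal A).

Lemma ext_ideal_subproof : is_ideal (smallest (@is_ideal B) (f @` I)).
Proof.
split=> [J [[]]//|x y Sx Sy J sJ|a x Sx J sJ]; case: (sJ) => -[_ JD JM] _.
- by apply: JD; [apply: Sx | apply: Sy].
- by apply: JM; apply: Sx.
Qed.

Definition ext_ideal : ideal B := Ideal ext_ideal_subproof.

End ExtendedIdeal.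

Record mulset (R : comPzRingType) := MulSet {
  mulset_set :> R -> Prop;
  mulset1 : mulset_set 1;
  mulsetM : forall x y, mulset_set x -> mulset_set y -> mulset_set (x * y)
}.

(* The localization S^-1 R: classes of fractions a/s with s in S, where
   a/s = b/t iff u (a t - b s) = 0 for some u in S. *)
Section Localization.
Variables (R : comPzRingType) (S : mulset R).

Definition denom : Type := {s : R | s \in (S : set R)}.
HB.instance Definition _ := Choice.on denom.

Lemma denomP (s : denom) : S (val s).
Proof. by apply/set_mem/(valP s). Qed.
Definition mk_denom s (Ss : S s) : denom := exist _ s (mem_set Ss).
Definition denom1 : denom := mk_denom (mulset1 S).
Definition denomM (s t : denom) : denom :=
  mk_denom (mulsetM (denomP s) (denomP t)).

Definition loc_eq (p q : R * denom) : Prop :=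
  exists2 u, S u & u * (p.1 * val q.2 - q.1 * val p.2) = 0.
Definition loc_rel (p q : R * denom) : bool := `[< loc_eq p q >].

Lemma loc_refl : reflexive loc_rel.
Proof.
move=> p; apply/asboolP; exists 1; first exact: mulset1.
by rewrite subrr mulr0.
Qed.
Lemma loc_sym : symmetric loc_rel.
Proof.
have h p q : loc_eq p q -> loc_eq q p.
  by move=> [u Su e]; exists u => //; rewrite -opprB mulrN e oppr0.
by move=> p q; apply: asbool_equiv_eq; split; apply: h.
Qed.
Lemma loc_trans : transitive loc_rel.
Proof.
move=> [b [t St']] [a [s Ss']] [c [w Sw']] /=.
move=> /asboolP[u Su /= e1] /asboolP[v Sv /= e2]; apply/asboolP.
exists (u * v * t); first by do !apply: mulsetM => //; apply/set_mem.
rewrite /=.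
have -> : u * v * t * (a * w - c * s) =
  v * w * (u * (a * t - b * s)) + u * s * (v * (b * w - c * t)) by ring.
by rewrite e1 e2 !mulr0 addr0.
Qed.

Canonical loc_equiv := EquivRel loc_rel loc_refl loc_sym loc_trans.

Definition loc : Type := {eq_quot loc_rel}.
HB.instance Definition _ := Choice.on loc.

Definition frac (a : R) (s : denom) : loc := \pi_({eq_quot loc_rel}) (a, s).

Lemma fracP a s b t : frac a s = frac b t <->
  exists2 u, S u & u * (a * val t - b * val s) = 0.
Proof. by split=> [/eqmodP/asboolP//|h]; apply/eqmodP/asboolP. Qed.

Lemma frac_eq a s b t : a * val t = b * val s -> frac a s = frac b t.
Proof.
by move=> e; apply/fracP; exists 1; rewrite ?e ?subrr ?mulr0//; apply: mulset1.
Qed.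

Definition loc_num (x : loc) : R := (repr (x : {eq_quot loc_rel})).1.
Definition loc_den (x : loc) : denom := (repr (x : {eq_quot loc_rel})).2.

Lemma loc_fracK x : frac (loc_num x) (loc_den x) = x.
Proof. by rewrite /frac /loc_num /loc_den -surjective_pairing reprK. Qed.

Lemma loc_ind (P : loc -> Prop) : (forall a s, P (frac a s)) -> forall x, P x.
Proof. by move=> h x; rewrite -(loc_fracK x). Qed.

Definition loc_zero : loc := frac 0 denom1.
Definition loc_one : loc := frac 1 denom1.
Definition loc_opp (x : loc) : loc := frac (- loc_num x) (loc_den x).
Definition loc_add (x y : loc) : loc :=
  frac (loc_num x * val (loc_den y) + loc_num y * val (loc_den x))
       (denomM (loc_den x) (loc_den y)).
Definition loc_mul (x y : loc) : loc :=
  frac (loc_num x * loc_num y) (denomM (loc_den x) (loc_den y)).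

Lemma frac_repr a s : exists2 u, S u &
  u * (loc_num (frac a s) * val s - a * val (loc_den (frac a s))) = 0.
Proof. by apply/fracP; rewrite loc_fracK. Qed.

Lemma loc_oppE a s : loc_opp (frac a s) = frac (- a) s.
Proof.
have [u Su e] := frac_repr a s; apply/fracP; exists u => //.
by rewrite !mulNr -opprD mulrN e oppr0.
Qed.
Lemma loc_addE a s b t : loc_add (frac a s) (frac b t) =
  frac (a * val t + b * val s) (denomM s t).
Proof.
have [u Su] := frac_repr a s; have [v Sv] := frac_repr b t.
rewrite /loc_add.
move: (loc_num (frac a s)) (loc_den (frac a s)) => a' s'.
move: (loc_num (frac b t)) (loc_den (frac b t)) => b' t' e2 e1; apply/fracP; exists (u * v); first exact: mulsetM.
rewrite /=; set X := val s; set Y := val t; set X' := val s'; set Y' := val t'.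
transitivity (v * Y * Y' * (u * (a' * X - a * X')) +
              u * X * X' * (v * (b' * Y - b * Y'))); first by ring.
by rewrite e1 e2 !mulr0 addr0.
Qed.
Lemma loc_mulE a s b t : loc_mul (frac a s) (frac b t) =
  frac (a * b) (denomM s t).
Proof.
have [u Su] := frac_repr a s; have [v Sv] := frac_repr b t.
rewrite /loc_mul.
move: (loc_num (frac a s)) (loc_den (frac a s)) => a' s'.
move: (loc_num (frac b t)) (loc_den (frac b t)) => b' t' e2 e1; apply/fracP; exists (u * v); first exact: mulsetM.
rewrite /=; set X := val s; set Y := val t; set X' := val s'; set Y' := val t'.
transitivity (v * b' * Y * (u * (a' * X - a * X')) +
              u * a * X' * (v * (b' * Y - b * Y'))); first by ring.
by rewrite e1 e2 !mulr0 addr0.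
Qed.

Lemma loc_addA : associative loc_add.
Proof.
elim/loc_ind=> a s; elim/loc_ind=> b t; elim/loc_ind=> c w.
by rewrite !loc_addE; apply: frac_eq => /=; ring.
Qed.
Lemma loc_addC : commutative loc_add.
Proof.
elim/loc_ind=> a s; elim/loc_ind=> b t.
by rewrite !loc_addE; apply: frac_eq => /=; ring.
Qed.
Lemma loc_add0 : left_id loc_zero loc_add.
Proof. by elim/loc_ind=> a s; rewrite loc_addE; apply: frac_eq => /=; ring. Qed.
Lemma loc_addN : left_inverse loc_zero loc_opp loc_add.
Proof.
by elim/loc_ind=> a s; rewrite loc_oppE loc_addE; apply: frac_eq => /=; ring.
Qed.
Lemma loc_mulA : associative loc_mul.
Proof.
elim/loc_ind=> a s; elim/loc_ind=> b t; elim/loc_ind=> c w.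
by rewrite !loc_mulE; apply: frac_eq => /=; ring.
Qed.
Lemma loc_mulC : commutative loc_mul.
Proof.
elim/loc_ind=> a s; elim/loc_ind=> b t.
by rewrite !loc_mulE; apply: frac_eq => /=; ring.
Qed.
Lemma loc_mul1 : left_id loc_one loc_mul.
Proof. by elim/loc_ind=> a s; rewrite loc_mulE; apply: frac_eq => /=; ring. Qed.
Lemma loc_mulDl : left_distributive loc_mul loc_add.
Proof.
elim/loc_ind=> a s; elim/loc_ind=> b t; elim/loc_ind=> c w.
by rewrite !(loc_mulE, loc_addE); apply: frac_eq => /=; ring.
Qed.

HB.instance Definition _ := GRing.isZmodule.Build loc
  loc_addA loc_addC loc_add0 loc_addN.
HB.instance Definition _ := GRing.Zmodule_isComPzRing.Build loc
  loc_mulA loc_mulC loc_mul1 loc_mulDl.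

Definition loc_inj (a : R) : loc := frac a denom1.

Lemma loc_inj_zmod : zmod_morphism loc_inj.
Proof.
move=> a b; rewrite -[RHS]/(loc_add (frac a _) (loc_opp (frac b _))).
by rewrite loc_oppE loc_addE; apply: frac_eq => /=; ring.
Qed.
Lemma loc_inj_monoid : monoid_morphism loc_inj.
Proof.
split=> // a b; rewrite -[RHS]/(loc_mul (frac a _) (frac b _)).
by rewrite loc_mulE; apply: frac_eq => /=; ring.
Qed.

HB.instance Definition _ := GRing.isZmodMorphism.Build R loc loc_inj loc_inj_zmod.
HB.instance Definition _ :=
  GRing.isMonoidMorphism.Build R loc loc_inj loc_inj_monoid.

End Localization.

(* k_A(P) = A_P / P A_P with its canonical map from A. *)
Section ResidueField.
Variables (A : comPzRingType) (P : spec A).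

Lemma prime_compl1 : (~` (P : set A)) 1.
Proof. by have [/properP] := spec_prime P. Qed.
Lemma prime_complM x y :
  (~` (P : set A)) x -> (~` (P : set A)) y -> (~` (P : set A)) (x * y).
Proof. by move=> Px Py Pxy; have [_ /(_ _ _ Pxy)[]] := spec_prime P. Qed.

Definition prime_compl : mulset A := MulSet prime_compl1 prime_complM.

Definition loc_at : comPzRingType := loc prime_compl.

Definition loc_at_inj : {rmorphism A -> loc_at} := loc_inj prime_compl.

Definition residue_field : comPzRingType := quot_ring (ext_ideal loc_at_inj P).

Definition to_residue_field : {rmorphism A -> residue_field} :=
  quot_proj (ext_ideal loc_at_inj P) \o loc_at_inj.

End ResidueField.

(* The tensor product K (x)_A B of two A-algebras f : A -> K and g : A -> B.
   A finite sum of pure tensors is encoded as a list of pairs; two lists are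
   identified by the congruence generated by biadditivity and A-balancedness.
   Negation needs no formal inverses, as -(x (x) y) = (-x) (x) y. *)
Section TensorProduct.
Variables (A K B : comPzRingType) (f : {rmorphism A -> K}) (g : {rmorphism A -> B}).

Inductive tens_eq : seq (K * B) -> seq (K * B) -> Prop :=
| tens_eq_refl s : tens_eq s s
| tens_eq_sym s t : tens_eq s t -> tens_eq t s
| tens_eq_trans s t u : tens_eq s t -> tens_eq t u -> tens_eq s u
| tens_eq_cat s s' t t' :
    tens_eq s s' -> tens_eq t t' -> tens_eq (s ++ t) (s' ++ t')
| tens_eq_catC s t : tens_eq (s ++ t) (t ++ s)
| tens_eq_zero y : tens_eq [:: (0, y)] [::]
| tens_eq_addl x x' y : tens_eq [:: (x + x', y)] [:: (x, y); (x', y)]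
| tens_eq_addr x y y' : tens_eq [:: (x, y + y')] [:: (x, y); (x, y')]
| tens_eq_bal a x y : tens_eq [:: (f a * x, y)] [:: (x, g a * y)].

Definition tens_rel (s t : seq (K * B)) : bool := `[< tens_eq s t >].

Lemma tens_refl : reflexive tens_rel.
Proof. by move=> s; apply/asboolP/tens_eq_refl. Qed.
Lemma tens_sym : symmetric tens_rel.
Proof.
by move=> s t; apply: asbool_equiv_eq; split; apply: tens_eq_sym.
Qed.
Lemma tens_trans : transitive tens_rel.
Proof.
move=> t s u /asboolP st /asboolP tu; apply/asboolP.
exact: tens_eq_trans tu.
Qed.

Canonical tens_equiv := EquivRel tens_rel tens_refl tens_sym tens_trans.

Definition tensor : Type := {eq_quot tens_rel}.
HB.instance Definition _ := Choice.on tensor.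

Definition tens_class (s : seq (K * B)) : tensor := \pi_({eq_quot tens_rel}) s.
Definition tens_repr (u : tensor) : seq (K * B) := repr (u : {eq_quot tens_rel}).

Lemma tens_classP s t : tens_class s = tens_class t <-> tens_eq s t.
Proof. by split=> [/eqmodP/asboolP//|h]; apply/eqmodP/asboolP. Qed.
Lemma tens_reprK u : tens_class (tens_repr u) = u.
Proof. exact: reprK. Qed.
Lemma tens_repr_class s : tens_eq (tens_repr (tens_class s)) s.
Proof. by apply/tens_classP; rewrite tens_reprK. Qed.
Lemma tens_class_ind (P : tensor -> Prop) :
  (forall s, P (tens_class s)) -> forall u, P u.
Proof. by move=> h u; rewrite -(tens_reprK u). Qed.

Definition opp_seq (s : seq (K * B)) := [seq (- p.1, p.2) | p <- s].
Definition mul_pair (p q : K * B) : K * B := (p.1 * q.1, p.2 * q.2).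
Definition mul_seq (s t : seq (K * B)) := [seq mul_pair p q | p <- s, q <- t].

Lemma opp_seq_eq s t : tens_eq s t -> tens_eq (opp_seq s) (opp_seq t).
Proof.
elim=> {s t} [s|s t _ h|s t u _ h1 _ h2|s s' t t' _ h1 _ h2|s t|y|x x' y|x y y'|a x y].
- exact: tens_eq_refl.
- exact: tens_eq_sym.
- exact: tens_eq_trans h2.
- by rewrite /opp_seq !map_cat; apply: tens_eq_cat.
- by rewrite /opp_seq !map_cat; apply: tens_eq_catC.
- by rewrite /= oppr0; apply: tens_eq_zero.
- by rewrite /= opprD; apply: tens_eq_addl.
- exact: tens_eq_addr.
- by rewrite /= -mulrN; apply: tens_eq_bal.
Qed.

Lemma mul_seq_catr s t t' : tens_eq (mul_seq s (t ++ t')) (mul_seq s t ++ mul_seq s t').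
Proof.
elim: s => [|p s IH]; first exact: tens_eq_refl.
rewrite /mul_seq /= map_cat -!catA; apply: tens_eq_cat; first exact: tens_eq_refl.
apply: tens_eq_trans (tens_eq_cat (tens_eq_refl _) IH) _.
rewrite /mul_seq !catA; apply: tens_eq_cat; last exact: tens_eq_refl.
exact: tens_eq_catC.
Qed.

Lemma mul_seqC s t : tens_eq (mul_seq s t) (mul_seq t s).
Proof.
elim: s => [|p s IH].
  by elim: t => [|q t IHt]; first exact: tens_eq_refl.
rewrite -[p :: s]cat1s; apply: tens_eq_trans (tens_eq_sym (mul_seq_catr _ _ _)).
rewrite [mul_seq (_ ++ _) _]allpairs_cat; apply: tens_eq_cat IH.
rewrite /mul_seq /= cats0; have -> : [seq mul_pair q r | q <- t, r <- [:: p]] = [seq mul_pair p q | q <- t].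
  by elim: t => //= q t ->; rewrite /mul_pair ![p.1 * _]mulrC ![p.2 * _]mulrC.
exact: tens_eq_refl.
Qed.

Lemma mul_seq_map p s t : tens_eq s t ->
  tens_eq [seq mul_pair p q | q <- s] [seq mul_pair p q | q <- t].
Proof.
elim=> {s t} [s|s t _ h|s t u _ h1 _ h2|s s' t t' _ h1 _ h2|s t|y|x x' y|x y y'|a x y].
- exact: tens_eq_refl.
- exact: tens_eq_sym.
- exact: tens_eq_trans h2.
- by rewrite !map_cat; apply: tens_eq_cat.
- by rewrite !map_cat; apply: tens_eq_catC.
- by rewrite /= /mul_pair mulr0; apply: tens_eq_zero.
- by rewrite /= /mul_pair /= mulrDr; apply: tens_eq_addl.
- by rewrite /= /mul_pair /= mulrDr; apply: tens_eq_addr.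
- by rewrite /= /mul_pair /= (mulrCA _ (f a)) (mulrCA _ (g a)); apply: tens_eq_bal.
Qed.

Lemma mul_seq_eqr s t t' : tens_eq t t' -> tens_eq (mul_seq s t) (mul_seq s t').
Proof.
move=> e; elim: s => [|p s IH]; first exact: tens_eq_refl.
by apply: tens_eq_cat IH; apply: mul_seq_map.
Qed.

Lemma mul_seq_eq s s' t t' :
  tens_eq s s' -> tens_eq t t' -> tens_eq (mul_seq s t) (mul_seq s' t').
Proof.
move=> e1 e2; apply: tens_eq_trans (mul_seq_eqr _ e2) _.
apply: tens_eq_trans (mul_seqC _ _) _.
by apply: tens_eq_trans (mul_seqC _ _); apply: mul_seq_eqr.
Qed.

Definition tens_zero : tensor := tens_class [::].
Definition tens_add (u v : tensor) : tensor :=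
  tens_class (tens_repr u ++ tens_repr v).
Definition tens_opp (u : tensor) : tensor := tens_class (opp_seq (tens_repr u)).
Definition tens_one : tensor := tens_class [:: (1, 1)].
Definition tens_mul (u v : tensor) : tensor :=
  tens_class (mul_seq (tens_repr u) (tens_repr v)).

Lemma tens_addE s t : tens_add (tens_class s) (tens_class t) = tens_class (s ++ t).
Proof. by apply/tens_classP/tens_eq_cat; apply: tens_repr_class. Qed.
Lemma tens_oppE s : tens_opp (tens_class s) = tens_class (opp_seq s).
Proof. by apply/tens_classP/opp_seq_eq; apply: tens_repr_class. Qed.
Lemma tens_mulE s t : tens_mul (tens_class s) (tens_class t) = tens_class (mul_seq s t).
Proof. by apply/tens_classP/mul_seq_eq; apply: tens_repr_class. Qed.

Lemma tens_addA : associative tens_add.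
Proof.
elim/tens_class_ind=> s; elim/tens_class_ind=> t; elim/tens_class_ind=> u.
by rewrite !tens_addE catA.
Qed.
Lemma tens_addC : commutative tens_add.
Proof.
elim/tens_class_ind=> s; elim/tens_class_ind=> t.
by rewrite !tens_addE; apply/tens_classP/tens_eq_catC.
Qed.
Lemma tens_add0 : left_id tens_zero tens_add.
Proof. by elim/tens_class_ind=> s; rewrite tens_addE. Qed.
Lemma tens_addN : left_inverse tens_zero tens_opp tens_add.
Proof.
elim/tens_class_ind; elim=> [|[x y] s IH]; first by rewrite tens_oppE tens_addE.
rewrite tens_oppE tens_addE; apply/tens_classP.
apply: (@tens_eq_trans _ ([:: (- x, y); (x, y)] ++ (opp_seq s ++ s))).
  change (tens_eq ([:: (- x, y)] ++ (opp_seq s ++ ([:: (x, y)] ++ s)))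
                  ([:: (- x, y)] ++ ([:: (x, y)] ++ (opp_seq s ++ s)))).
  apply: tens_eq_cat; first exact: tens_eq_refl.
  rewrite !catA.
  by apply: tens_eq_cat; [apply: tens_eq_catC | apply: tens_eq_refl].
apply: (@tens_eq_cat _ [::] _ [::]).
  apply: tens_eq_trans (tens_eq_sym (tens_eq_addl _ _ _)) _.
  by rewrite addNr; apply: tens_eq_zero.
by apply/tens_classP; rewrite -tens_addE -tens_oppE.
Qed.
Lemma tens_mulA : associative tens_mul.
Proof.
elim/tens_class_ind=> s; elim/tens_class_ind=> t; elim/tens_class_ind=> u.
rewrite !tens_mulE; congr tens_class.
elim: s => //= p s IH; rewrite /mul_seq allpairs_cat /= -/(mul_seq _ _).
rewrite -/(mul_seq (mul_seq s t) u) -IH; congr cat.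
rewrite {IH}; elim: t => //= q t <-; rewrite map_cat -map_comp; congr cat.
by apply: eq_map => r; rewrite /mul_pair /= !mulrA.
Qed.
Lemma tens_mulC : commutative tens_mul.
Proof.
elim/tens_class_ind=> s; elim/tens_class_ind=> t.
by rewrite !tens_mulE; apply/tens_classP/mul_seqC.
Qed.
Lemma tens_mul1 : left_id tens_one tens_mul.
Proof.
elim/tens_class_ind=> s; rewrite tens_mulE /mul_seq /= cats0.
by rewrite map_id_in// => -[x y] _; rewrite /mul_pair !mul1r.
Qed.
Lemma tens_mulDl : left_distributive tens_mul tens_add.
Proof.
elim/tens_class_ind=> s; elim/tens_class_ind=> t; elim/tens_class_ind=> u.
by rewrite !(tens_mulE, tens_addE) /mul_seq allpairs_cat.
Qed.

HB.instance Definition _ := GRing.isZmodule.Build tensor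
  tens_addA tens_addC tens_add0 tens_addN.
HB.instance Definition _ := GRing.Zmodule_isComPzRing.Build tensor
  tens_mulA tens_mulC tens_mul1 tens_mulDl.

Definition pure (x : K) (y : B) : tensor := tens_class [:: (x, y)].

Lemma tens_classE s : tens_class s = \sum_(p <- s) pure p.1 p.2.
Proof.
elim: s => [|[x y] s IH]; first by rewrite big_nil.
by rewrite big_cons -IH /= -[RHS]/(tens_add _ _) tens_addE.
Qed.
Lemma pureDl x x' y : pure (x + x') y = pure x y + pure x' y.
Proof.
by rewrite -[RHS]/(tens_add _ _) tens_addE; apply/tens_classP/tens_eq_addl.
Qed.
Lemma pureDr x y y' : pure x (y + y') = pure x y + pure x y'.
Proof.
by rewrite -[RHS]/(tens_add _ _) tens_addE; apply/tens_classP/tens_eq_addr.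
Qed.
Lemma pure_bal a x y : pure (f a * x) y = pure x (g a * y).
Proof. by apply/tens_classP/tens_eq_bal. Qed.
Lemma pureM x y x' y' : pure x y * pure x' y' = pure (x * x') (y * y').
Proof. by rewrite -[LHS]/(tens_mul _ _) tens_mulE. Qed.

(* Universal property: balanced biadditive maps factor through [tensor]. *)
Section Lift.
Variables (V : zmodType) (h : K -> B -> V).
Hypothesis hDl : forall x x' y, h (x + x') y = h x y + h x' y.
Hypothesis hDr : forall x y y', h x (y + y') = h x y + h x y'.
Hypothesis h_bal : forall a x y, h (f a * x) y = h x (g a * y).

Lemma tens_lift_eq s t : tens_eq s t ->
  \sum_(p <- s) h p.1 p.2 = \sum_(p <- t) h p.1 p.2.
Proof.
elim=> {s t} [s|s t _ e|s t u _ e1 _ e2|s s' t t' _ e1 _ e2|s t|y|x x' y|x y y'|a x y].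
- by [].
- by [].
- by rewrite e1.
- by rewrite !big_cat /= e1 e2.
- by rewrite !big_cat /= addrC.
- rewrite big_seq1 big_nil /=.
  by apply: (addrI (h 0 y)); rewrite addr0 -hDl addr0.
- by rewrite big_seq1 !big_cons big_nil addr0 hDl.
- by rewrite big_seq1 !big_cons big_nil addr0 hDr.
- by rewrite !big_seq1 h_bal.
Qed.

Lemma tens_lift : exists! phi : tensor -> V,
  (forall u v, phi (u + v) = phi u + phi v) /\
  (forall x y, phi (pure x y) = h x y).
Proof.
pose phi (u : tensor) := \sum_(p <- tens_repr u) h p.1 p.2.
have phiE s : phi (tens_class s) = \sum_(p <- s) h p.1 p.2.
  by apply: tens_lift_eq; apply: tens_repr_class.
have phiD u v : phi (u + v) = phi u + phi v.
  elim/tens_class_ind: u => s; elim/tens_class_ind: v => t.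
  by rewrite -[_ + _ in LHS]/(tens_add _ _) tens_addE !phiE big_cat.
exists phi; split; first by split=> // x y; rewrite phiE big_seq1.
move=> psi [psiD psiE]; apply/funext; elim/tens_class_ind=> s; rewrite phiE.
elim: s => [|[x y] s IH].
  rewrite big_nil; apply: (addrI (psi 0)); rewrite -psiD.
  by rewrite -[tens_class _]/(0 : tensor) !addr0.
rewrite big_cons IH -psiE -psiD; congr psi.
by rewrite -[LHS]/(tens_add _ _) tens_addE.
Qed.

End Lift.

Definition tens_inl (x : K) : tensor := pure x 1.

Lemma tens_inl_zmod : zmod_morphism tens_inl.
Proof. by move=> x y; apply/eqP; rewrite eq_sym subr_eq -pureDl subrK. Qed.
Lemma tens_inl_monoid : monoid_morphism tens_inl.
Proof. by split=> // x y; rewrite pureM mulr1. Qed.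

HB.instance Definition _ := GRing.isZmodMorphism.Build K tensor tens_inl tens_inl_zmod.
HB.instance Definition _ :=
  GRing.isMonoidMorphism.Build K tensor tens_inl tens_inl_monoid.

End TensorProduct.

(* A ring extension is presented by its inclusion map. *)
Record ring_extension (A B : comPzRingType) := RingExtension {
  ext_map :> {rmorphism A -> B};
  ext_inj : injective ext_map
}.

Definition prime_over (A B : comPzRingType) (e : ring_extension A B)
    (J : ideal B) : Prop :=
  is_proper J /\ forall (a : A) (b : B), J (e a * b) -> J (e a) \/ J b.

Definition PSI_extension (A B : comPzRingType) (e : ring_extension A B) : Prop :=
  forall J : ideal B, prime_over e J -> prime_ideal J.

Definition residue_tensor (A B : comPzRingType) (e : ring_extension A B)
    (P : spec A) : comPzRingType := tensor (to_residue_field P) e.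

Definition residue_tensor_map (A B : comPzRingType) (e : ring_extension A B)
    (P : spec A) : {rmorphism residue_field P -> residue_tensor e P} :=
  tens_inl (to_residue_field P) e.

Definition strong_PSI_extension (A B : comPzRingType) (e : ring_extension A B) : Prop :=
  forall P : spec A, (exists t : residue_tensor e P, t != 0) ->
    bijective (residue_tensor_map e P).

(* An ideal of A and an ideal of B that are the same subset of B. *)
Record common_ideal (A B : comPzRingType) (e : ring_extension A B) := CommonIdeal {
  common_sub : ideal A;
  common_top : ideal B;
  commonP : e @` common_sub = common_top
}.

Section QuotientExtension.
Variables (A B : comPzRingType) (e : ring_extension A B) (I : common_ideal e).

Lemma common_subset : e @` common_sub I `<=` common_top I.
Proof. by rewrite commonP. Qed.

Lemma quot_extension_inj : injective (quot_map common_subset).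
Proof.
move=> u v; rewrite -[u]quot_reprK -[v]quot_reprK !quot_map_proj.
move=> /quot_projP; rewrite -rmorphB -commonP => -[x Ix /ext_inj xE].
by apply/quot_projP; rewrite -xE.
Qed.

Definition quot_extension :
    ring_extension (quot_ring (common_sub I)) (quot_ring (common_top I)) :=
  RingExtension quot_extension_inj.

End QuotientExtension.

(* Main.v *)
Require Import Defs.
From HB Require Import structures.
From mathcomp Require Import all_boot all_order all_algebra.
From mathcomp Require Import boolp classical_sets.
From mathcomp Require Import ring.
(* The second import makes [frac] a fraction in a localization and [properP] a
   statement on proper ideals, over the homonyms for fields and finite sets. *)
Import Defs.

(** The argument is a dichotomy on whether an ideal contains [I].

    Ideals containing [I] correspond to ideals of the quotient by [I], and both
    extension conditions are read off the same on the two sides of this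
    correspondence.  Ideals that do not contain [I] satisfy the conclusions
    unconditionally, because an element [i] of [I] outside the ideal is a
    denominator that carries [B] into [A]: for every [b] in [B] the product
    [i b] lies in [I], hence in [A].
    - If [J] is [A]-prime, [i] is not in [J] and [x y] is in [J], then
      [(i x) y] is in [J] with [i x] in [A], so [y] is in [J] or [i x] is in
      [J], and in the latter case so is [x]
      ([prime_of_prime_over_not_containing]).
    - If [P] is a prime of [A] and [i] is not in [P], then every [b] is the
      fraction [(i b) / i] of elements of [A] ([fractional_fiber_outside]).

    For the strong condition, the correspondence is awkward to see through the
    tensor products themselves, so the fiber of [B] over [P] is first described
    by elements: [k(P) (x) B] is [B_P / P B_P], hence it vanishes iff [P B]
    meets the complement of [P] ([residue_tensor_nonzeroP]), and when it does
    not vanish the map from the field [k(P)] is an isomorphism iff every [b] in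
    [B] agrees with some fraction [a / s] modulo [P B_P]
    ([strong_PSI_extensionP]).  That equalities in the tensor product come from
    equalities modulo [P B] is seen by mapping it to [B_P / P B_P]
    ([pure_eqP]).  If [P] contains [I], then [P B] contains [I] and is
    the preimage of the ideal generated by [P/I] in [B/I]
    ([corresponds_ext_ideal]), so the fibers over [P] and over [P/I] satisfy the
    same conditions. *)

Set Implicit Arguments.
Unset Strict Implicit.
Unset Printing Implicit Defensive.

Import GRing.Theory.

Local Open Scope classical_set_scope.
Local Open Scope ring_scope.

(** * Ideals of a quotient ring *)

Section Preimage.
Variables (A B : comPzRingType) (f : {rmorphism A -> B}) (J : ideal B).

Lemma preim_ideal_subproof : is_ideal (f @^-1` J).
Proof.
split=> [|x y Jx Jy|a x Jx] /=.
- by rewrite rmorph0; apply: ideal0.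
- by rewrite rmorphD; apply: idealD.
- by rewrite rmorphM; apply: idealMl.
Qed.

Definition preim_ideal : ideal A := Ideal preim_ideal_subproof.

End Preimage.

Section ExtendedIdealFacts.
Variables (A B : comPzRingType) (f : {rmorphism A -> B}) (I : ideal A).

Lemma mem_ext_ideal a : I a -> ext_ideal f I (f a).
Proof. by move=> Ia J [_ sJ]; apply: sJ; exists a. Qed.

Lemma ext_ideal_sub (J : ideal B) :
  (forall a, I a -> J (f a)) -> forall b, ext_ideal f I b -> J b.
Proof.
move=> sJ b; apply; split; first exact: idealP.
by move=> _ [a Ia <-]; apply: sJ.
Qed.

End ExtendedIdealFacts.

Section QuotientIdeals.
Variables (R : comPzRingType) (I : ideal R).

Lemma quot_proj0 x : I x -> quot_proj I x = 0.
Proof.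
by move=> Ix; rewrite -(rmorph0 (quot_proj I)); apply/quot_projP; rewrite subr0.
Qed.

Section Image.
Variables (J : ideal R) (sIJ : forall x, I x -> J x).

Lemma quot_repr_mem x : J (quot_repr (quot_proj I x)) <-> J x.
Proof.
have /sIJ Jd : I (x - quot_repr (quot_proj I x)).
  by apply/quot_projP; rewrite quot_reprK.
split=> Jx; last by rewrite -[quot_repr _](subKr x); apply: idealB.
by rewrite -[x](subrK (quot_repr (quot_proj I x))); apply: idealD.
Qed.

Lemma quot_ideal_subproof : is_ideal (fun u : quot_ring I => J (quot_repr u)).
Proof.
split=> [|u v|u v].
- by rewrite -(rmorph0 (quot_proj I)); apply/quot_repr_mem/ideal0.
- move=> Ju Jv; rewrite -[u]quot_reprK -[v]quot_reprK -rmorphD.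
  exact/quot_repr_mem/idealD.
- move=> Jv; rewrite -[u]quot_reprK -[v]quot_reprK -rmorphM.
  exact/quot_repr_mem/idealMl.
Qed.

Definition quot_ideal : ideal (quot_ring I) := Ideal quot_ideal_subproof.

End Image.

(** The correspondence between ideals of [R] containing [I] and ideals of
    [R/I], as a relation, so that one transfer lemma serves both directions. *)
Definition corresponds (J : ideal R) (J' : ideal (quot_ring I)) : Prop :=
  forall x, J' (quot_proj I x) <-> J x.

Lemma corresponds_preim (J' : ideal (quot_ring I)) :
  corresponds (preim_ideal (quot_proj I) J') J'.
Proof. by []. Qed.

Lemma corresponds_quot (J : ideal R) (sIJ : forall x, I x -> J x) :
  corresponds J (quot_ideal sIJ).
Proof. by move=> x; apply: quot_repr_mem. Qed.

Section Corresponds.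
Variables (J : ideal R) (J' : ideal (quot_ring I)) (JJ' : corresponds J J').

Lemma corresponds_subset x : I x -> J x.
Proof. by move=> Ix; apply/JJ'; rewrite quot_proj0//; apply: ideal0. Qed.

Lemma corresponds_proper : is_proper J' <-> is_proper J.
Proof.
have J1 := JJ' 1; rewrite rmorph1 in J1.
by rewrite !properP J1.
Qed.

Lemma corresponds_prime : prime_ideal J' <-> prime_ideal J.
Proof.
split=> -[/corresponds_proper pJ JM]; split=> //.
  by move=> x y /JJ'; rewrite rmorphM => /JM[] /JJ'; [left|right].
move=> u v; rewrite -[u]quot_reprK -[v]quot_reprK -rmorphM.
by move=> /JJ'/JM[] /JJ'; [left|right].
Qed.

End Corresponds.

End QuotientIdeals.

(** * The case of ideals that do not contain the common ideal *)

Section CommonIdeal.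
Variables (A B : comPzRingType) (e : ring_extension A B) (I : common_ideal e).

Lemma common_top_map a : common_sub I a -> common_top I (e a).
Proof. by move=> Ia; rewrite -commonP; exists a. Qed.

Lemma common_mulP i b : common_sub I i -> exists a, e a = e i * b.
Proof.
move=> Ii; have : common_top I (e i * b).
  by rewrite mulrC; apply: idealMl; apply: common_top_map.
by rewrite -commonP => -[a _ <-]; exists a.
Qed.

Lemma quot_extension_proj a : quot_extension I (quot_proj _ a) = quot_proj _ (e a).
Proof. exact: quot_map_proj. Qed.

(** Multiplication by an element [i] of [I] outside [J] turns [x] into an
    element of [A] without changing whether it lies in [J]. *)
Lemma prime_of_prime_over_not_containing (J : ideal B) :
  prime_over e J -> ~ (forall b, common_top I b -> J b) -> prime_ideal J.
Proof.
move=> [pJ JM] nIJ; split=> // x y Jxy.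
have [i Ii nJi] : exists2 i, common_sub I i & ~ J (e i).
  apply: contrapT => h; apply: nIJ => b; rewrite -commonP => -[i Ii <-].
  by apply: contrapT => nJ; apply: h; exists i.
have [a aE] := common_mulP x Ii.
have : J (e a * y) by rewrite aE -mulrA; apply: idealMl.
move=> /JM[|]; last by right.
by rewrite aE => /JM[/nJi|]; [|left].
Qed.

Lemma corresponds_prime_over (J : ideal B) (J' : ideal (quot_ring (common_top I))) :
  corresponds J J' -> prime_over (quot_extension I) J' <-> prime_over e J.
Proof.
move=> JJ'; split=> -[/(corresponds_proper JJ') pJ JM]; split=> //.
  move=> a b /JJ'; rewrite rmorphM /= -quot_extension_proj => /JM[]; last first.
    by move=> /JJ'; right.
  by rewrite quot_extension_proj => /JJ'; left.
move=> a b; rewrite -[a]quot_reprK -[b]quot_reprK !quot_extension_proj -rmorphM.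
by move=> /JJ'/JM[] /JJ'; [left|right].
Qed.

Lemma PSI_quot_extension : PSI_extension e <-> PSI_extension (quot_extension I).
Proof.
split=> psi J oJ.
  apply/(corresponds_prime (corresponds_preim J)); apply: psi.
  exact/(corresponds_prime_over (corresponds_preim J)).
have [sIJ|nIJ] := pselect (forall b, common_top I b -> J b); last first.
  exact: prime_of_prime_over_not_containing nIJ.
apply/(corresponds_prime (corresponds_quot sIJ)); apply: psi.
exact/(corresponds_prime_over (corresponds_quot sIJ)).
Qed.

End CommonIdeal.

(** * Functoriality of localization *)

Section Fractions.
Variables (R : comPzRingType) (S : mulset R).

Lemma frac_sub (s t : denom S) a b :
  frac a s - frac b t = frac (a * val t - b * val s) (denomM s t).
Proof.
rewrite -[LHS]/(loc_add (frac a s) (loc_opp (frac b t))) loc_oppE loc_addE.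
by rewrite mulNr.
Qed.

Lemma fracM (s t : denom S) a b : frac a s * frac b t = frac (a * b) (denomM s t).
Proof. exact: loc_mulE. Qed.

End Fractions.

Section LocalizationMap.
Variables (A B : comPzRingType) (f : {rmorphism A -> B}).
Variables (S : mulset A) (T : mulset B) (fST : forall s, S s -> T (f s)).

Definition denom_map (s : denom S) : denom T := mk_denom (fST (denomP s)).

Definition loc_map (x : loc S) : loc T :=
  frac (f (loc_num x)) (denom_map (loc_den x)).

Lemma loc_map_frac a s : loc_map (frac a s) = frac (f a) (denom_map s).
Proof.
have [u Su uE] := frac_repr a s; apply/fracP; exists (f u); first exact: fST.
by rewrite /= -!rmorphM -rmorphB -rmorphM uE rmorph0.
Qed.

Lemma loc_map_zmod : zmod_morphism loc_map.
Proof.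
elim/loc_ind=> a s; elim/loc_ind=> b t.
rewrite frac_sub !loc_map_frac frac_sub; apply: frac_eq => /=.
by rewrite !(rmorphM, rmorphB).
Qed.
Lemma loc_map_monoid : monoid_morphism loc_map.
Proof.
split=> [|x y].
  by rewrite -[1]/(frac 1 _) loc_map_frac; apply: frac_eq; rewrite /= !rmorph1.
elim/loc_ind: x => a s; elim/loc_ind: y => b t.
rewrite fracM !loc_map_frac fracM; apply: frac_eq => /=.
by rewrite !rmorphM.
Qed.

HB.instance Definition _ :=
  GRing.isZmodMorphism.Build (loc S) (loc T) loc_map loc_map_zmod.
HB.instance Definition _ :=
  GRing.isMonoidMorphism.Build (loc S) (loc T) loc_map loc_map_monoid.

End LocalizationMap.

(** The extension of [J] to the localization, written with its explicit
    elements: a sum of fractions with numerators in [J] has a common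
    denominator. *)
Section LocalizedIdeal.
Variables (R : comPzRingType) (S : mulset R) (J : ideal R).

Lemma loc_ideal_subproof :
  is_ideal (fun x : loc S => exists b s, J b /\ x = frac b s).
Proof.
split=> [|_ _ [b [s [Jb ->]]] [c [t [Jc ->]]]|x _ [b [s [Jb ->]]]].
- by exists 0, (denom1 S); split=> //; apply: ideal0.
- exists (b * val t + c * val s), (denomM s t); split; last first.
    by rewrite -[LHS]/(loc_add _ _) loc_addE.
  by rewrite ![_ * val _]mulrC; apply: idealD; apply: idealMl.
- elim/loc_ind: x => a t; exists (a * b), (denomM t s).
  by rewrite fracM; split=> //; apply: idealMl.
Qed.

Definition loc_ideal : ideal (loc S) := Ideal loc_ideal_subproof.

Lemma loc_idealP b s : loc_ideal (frac b s) -> exists2 u, S u & J (u * b).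
Proof.
move=> [c [t [Jc /fracP[u Su uE]]]]; exists (u * val t).
  exact: mulsetM Su (denomP t).
have -> : u * val t * b = u * (b * val t - c * val s) + (u * val s) * c by ring.
by rewrite uE add0r; apply: idealMl.
Qed.

End LocalizedIdeal.

(** * The fiber over a prime *)

Lemma pure1_mul (A K B : comPzRingType) (f : {rmorphism A -> K})
    (g : {rmorphism A -> B}) x y :
  pure f g x y = pure f g x 1 * pure f g 1 y.
Proof. by rewrite pureM mulr1 mul1r. Qed.

Lemma pure0l (A K B : comPzRingType) (f : {rmorphism A -> K})
    (g : {rmorphism A -> B}) y :
  pure f g 0 y = 0.
Proof. by apply: (addrI (pure f g 0 y)); rewrite -pureDl !addr0. Qed.

Section Fiber.
Variables (A B : comPzRingType) (e : ring_extension A B) (P : spec A).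

Local Notation S := (prime_compl P).
Local Notation k := (to_residue_field P).
Local Notation PB := (ext_ideal e P).

Definition residue_frac (a : A) (s : denom S) : residue_field P :=
  quot_proj (ext_ideal (loc_at_inj P) P) (frac a s).

Lemma residue_fracE a s : residue_frac a s * k (val s) = k a.
Proof.
rewrite /= -rmorphM /residue_frac; congr quot_proj.
by rewrite fracM; apply: frac_eq => /=; ring.
Qed.

Lemma residue_frac1_inv (s : denom S) : k (val s) * residue_frac 1 s = 1.
Proof. by rewrite mulrC residue_fracE rmorph1. Qed.

Lemma residue_frac1M a s : residue_frac a s = k a * residue_frac 1 s.
Proof. by rewrite -(residue_fracE a s) -mulrA residue_frac1_inv mulr1. Qed.

Lemma residue_frac_ind (Q : residue_field P -> Prop) :
  (forall a s, Q (residue_frac a s)) -> forall x, Q x.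
Proof.
move=> h x; rewrite -[x]quot_reprK; elim/loc_ind: (quot_repr x) => a s.
exact: h.
Qed.

Lemma to_residue_field0 p : P p -> k p = 0.
Proof.
by move=> Pp; apply: quot_proj0; exact: (mem_ext_ideal (f := loc_at_inj P) Pp).
Qed.

Lemma residue_field_inv (x : residue_field P) : x != 0 -> exists y, x * y = 1.
Proof.
elim/residue_frac_ind: x => a s.
have [Pa|nPa] := pselect (P a).
  suff -> : residue_frac a s = 0 by rewrite eqxx.
  by rewrite residue_frac1M to_residue_field0// mul0r.
move=> _; exists (residue_frac (val s) (@mk_denom _ S a nPa)).
rewrite /residue_frac -rmorphM fracM -[1]/(quot_proj _ (frac 1 _)).
by congr quot_proj; apply: frac_eq => /=; ring.
Qed.

(** The elements of [B] killed by every left factor form an ideal, which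
    contains [e(P)] because [P] maps to zero in [k(P)]. *)
Lemma pure_ext_ideal0 b : PB b -> forall x, pure k e x b = 0.
Proof.
have zI : is_ideal (fun b => forall x, pure k e x b = 0).
  split=> [x|b1 b2 z1 z2 x|c b0 z x].
  - by apply: (addrI (pure k e x 0)); rewrite -pureDr !addr0.
  - by rewrite pureDr z1 z2 addr0.
  - by rewrite -[x]mul1r -pureM z mulr0.
apply: (@ext_ideal_sub _ _ e P (Ideal zI)) => p Pp x.
by rewrite -[e p]mulr1 -pure_bal to_residue_field0// mul0r pure0l.
Qed.

Lemma image_compl1 : (e @` S) 1.
Proof. by exists 1; [apply: mulset1|rewrite rmorph1]. Qed.
Lemma image_complM x y : (e @` S) x -> (e @` S) y -> (e @` S) (x * y).
Proof.
move=> [s Ss <-] [t St <-].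
by exists (s * t); [apply: mulsetM|rewrite rmorphM].
Qed.

Definition image_compl : mulset B := MulSet image_compl1 image_complM.

Lemma image_compl_map s : S s -> image_compl (e s).
Proof. by move=> Ss; exists s. Qed.

Local Notation T := image_compl.
Local Notation eST := image_compl_map.
Local Notation PBP := (loc_ideal T PB).

(** One direction divides by [u] and by [s] on the left factor.  The other maps
    the tensor product to [B_P / P B_P], where equalities are known. *)
Lemma pure_eqP a s b : pure k e 1 b = pure k e (residue_frac a s) 1 <->
  exists2 u, ~ P u & PB (e u * (e (val s) * b - e a)).
Proof.
split=> [eq_t|[u nPu /pure_ext_ideal0 z]]; last first.
  (* The left factor [1 / (u s)] cancels the coefficients of [z]. *)
  pose v := @mk_denom _ S u nPu.
  have := z (residue_frac 1 v * residue_frac 1 s).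
  rewrite -pure_bal mulrA -[u]/(val v) residue_frac1_inv mul1r.
  rewrite pureDr -pure_bal residue_frac1_inv -rmorphN -[e (- a)]mulr1 -pure_bal.
  rewrite rmorphN mulNr -residue_frac1M => /eqP; rewrite addr_eq0 => /eqP ->.
  by apply/eqP; rewrite eq_sym -addr_eq0 -pureDl subrr pure0l.
pose toBP b0 := quot_proj PBP (loc_inj T b0).
have PP_PBP : loc_map eST @` ext_ideal (loc_at_inj P) P `<=` PBP.
  move=> _ [x Px <-]; move: x Px.
  apply: (@ext_ideal_sub _ _ (loc_at_inj P) P (preim_ideal (loc_map eST) PBP)).
  move=> p Pp; rewrite /= loc_map_frac; do 2 eexists; split=> //.
  exact: mem_ext_ideal.
(* The map [x (x) b |-> x b] from the tensor product to [B_P / P B_P]. *)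
pose h x b0 := quot_map PP_PBP x * toBP b0.
have hDl x x' y : h (x + x') y = h x y + h x' y by rewrite /h rmorphD mulrDl.
have hDr x y y' : h x (y + y') = h x y + h x y'.
  by rewrite /h /toBP !rmorphD mulrDr.
have h_bal c x y : h (k c * x) y = h x (e c * y).
  have -> : h (k c * x) y = toBP (e c) * quot_map PP_PBP x * toBP y.
    rewrite /h rmorphM; congr (_ * _ * _).
    rewrite [LHS]quot_map_proj [X in quot_proj _ X]loc_map_frac /toBP.
    by congr quot_proj; apply: frac_eq; rewrite /= rmorph1.
  by rewrite mulrAC /h /toBP !rmorphM /= mulrC.
have [phi [[_ phiE] _]] := tens_lift hDl hDr h_bal.
move: (congr1 phi eq_t); rewrite !phiE /h /toBP.
rewrite rmorph1 mul1r quot_map_proj /= loc_map_frac !rmorph1 mulr1 => /quot_projP.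
rewrite frac_sub => /loc_idealP[_ [u nPu <-] PBu]; exists u => //.
have <- : b * val (denom_map eST s) - e a * val (denom1 T) = e (val s) * b - e a.
  by rewrite /= mulr1 mulrC.
exact: PBu.
Qed.

Lemma residue_frac0 s : residue_frac 0 s = 0.
Proof.
rewrite -[RHS](rmorph0 (quot_proj _)); congr quot_proj.
by apply: frac_eq => /=; ring.
Qed.

(** The case of [pure_eqP] that compares [1] in [B] with the fraction [0 / 1]. *)
Lemma tensor_one_eq0P : (1 : residue_tensor e P) = 0 <-> exists2 s, ~ P s & PB (e s).
Proof.
have := pure_eqP 0 (denom1 S) 1.
rewrite residue_frac0 pure0l /= rmorph1 rmorph0 mulr1 subr0 => h.
by split=> [/h|] [s nPs PBs]; [|apply/h]; exists s; rewrite // ?mulr1// -[e s]mulr1.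
Qed.

Definition fiber_nonzero : Prop := forall s, ~ P s -> ~ PB (e s).

Lemma residue_tensor_nonzeroP :
  (exists t : residue_tensor e P, t != 0) <-> fiber_nonzero.
Proof.
split=> [[t /eqP t0] s nPs PBs|nz].
  apply: t0; rewrite -[t]mulr1 (_ : 1 = 0) ?mulr0//.
  by apply/tensor_one_eq0P; exists s.
by exists 1; apply/eqP => /tensor_one_eq0P[s /nz].
Qed.

(** Surjectivity of [k(P) -> k(P) (x) B] with all denominators cleared: the
    factor outside [P] that an equality in [B_P / P B_P] allows is absorbed by
    [a] and [s]. *)
Definition fractional_fiber : Prop :=
  forall b, exists a s, ~ P s /\ PB (e s * b - e a).

(** A ring morphism from a field to a nonzero ring is injective. *)
Lemma residue_tensor_map_inj : fiber_nonzero -> injective (residue_tensor_map e P).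
Proof.
move=> nz; apply: raddf_inj => x x0.
apply: contrapT => /eqP /residue_field_inv[y xy].
have [s /nz] : exists2 s, ~ P s & PB (e s); last by [].
apply/tensor_one_eq0P.
by rewrite -(rmorph1 (residue_tensor_map e P)) -xy rmorphM x0 mul0r.
Qed.

(** The tensors [1 (x) b] generate the tensor product over [k(P)], so it is
    enough to reach these. *)
Lemma residue_tensor_map_surj : fractional_fiber ->
  forall t, exists x, residue_tensor_map e P x = t.
Proof.
move=> ff; elim/tens_class_ind=> s; rewrite tens_classE.
elim: s => [|[x b] s [z IH]]; first by exists 0; rewrite big_nil rmorph0.
have [a [u [nPu PBu]]] := ff b.
have bE : pure k e 1 b = pure k e (residue_frac a (@mk_denom _ S u nPu)) 1.
  by apply/pure_eqP; exists 1; [apply: prime_compl1|rewrite rmorph1 mul1r].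
exists (x * residue_frac a (@mk_denom _ S u nPu) + z).
by rewrite big_cons rmorphD IH rmorphM pure1_mul bE.
Qed.

Lemma bijective_residue_tensor_mapP : fiber_nonzero ->
  bijective (residue_tensor_map e P) <-> fractional_fiber.
Proof.
move=> nz; split=> [[g _ gK] b|ff]; last first.
  have [g gK] := choice (residue_tensor_map_surj ff).
  exists g => // x; apply: (residue_tensor_map_inj nz); exact: gK.
have := gK (pure k e 1 b).
elim/residue_frac_ind: (g _) => a s /esym/pure_eqP[u nPu PBu].
exists (u * a), (u * val s); split.
  exact: prime_complM nPu (denomP s).
by rewrite !rmorphM -mulrA -mulrBr.
Qed.

End Fiber.

Lemma strong_PSI_extensionP (A B : comPzRingType) (e : ring_extension A B) :
  strong_PSI_extension e <->
  forall P : spec A, fiber_nonzero e P -> fractional_fiber e P.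
Proof.
split=> h P.
  move=> nz; apply/(bijective_residue_tensor_mapP nz)/h.
  exact/residue_tensor_nonzeroP.
move=> /residue_tensor_nonzeroP nz.
exact/(bijective_residue_tensor_mapP nz)/h.
Qed.

(** * Fibers of the quotient extension *)

Section QuotientFibers.
Variables (A B : comPzRingType) (e : ring_extension A B) (I : common_ideal e).

Section Corresponding.
Variables (P : spec A) (P' : spec (quot_ring (common_sub I))).
Hypothesis PP' : corresponds P P'.

(** [P B] contains [I], because [P] does and [I] is the same subset of [A] and
    of [B].  So [P B] is the preimage of its image in [B/I], and this image is
    the ideal generated by [P']. *)
Lemma corresponds_ext_ideal :
  corresponds (ext_ideal e P) (ext_ideal (quot_extension I) P').
Proof.
have sI b : common_top I b -> ext_ideal e P b.
  rewrite -commonP => -[a Ia <-].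
  by apply: mem_ext_ideal; apply: (corresponds_subset PP').
move=> b; split=> [b'|].
  apply/(corresponds_quot sI).
  apply: ext_ideal_sub b' => u; rewrite -[u]quot_reprK => /PP' Pa.
  rewrite quot_extension_proj; apply/(corresponds_quot sI).
  exact: mem_ext_ideal.
pose J := preim_ideal (quot_proj _) (ext_ideal (quot_extension I) P').
apply: (@ext_ideal_sub _ _ e P J) => p Pp /=.
by rewrite -quot_extension_proj; apply: mem_ext_ideal; apply/PP'.
Qed.

Lemma fiber_nonzero_quot : fiber_nonzero (quot_extension I) P' <-> fiber_nonzero e P.
Proof.
split=> nz s.
  move=> nPs PBs; apply: (nz (quot_proj _ s)); first by move=> /PP'.
  by rewrite quot_extension_proj; apply/corresponds_ext_ideal.
rewrite -[s]quot_reprK quot_extension_proj => nPs /corresponds_ext_ideal.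
by apply: nz => /PP'.
Qed.

Lemma fractional_fiber_quot :
  fractional_fiber (quot_extension I) P' <-> fractional_fiber e P.
Proof.
split=> ff b.
  have [a [s]] := ff (quot_proj _ b).
  rewrite -[a]quot_reprK -[s]quot_reprK !quot_extension_proj -rmorphM -rmorphB.
  move=> [nPs /corresponds_ext_ideal PBs].
  by exists (quot_repr a), (quot_repr s); split=> // /PP'.
have [a [s [nPs PBs]]] := ff (quot_repr b).
exists (quot_proj _ a), (quot_proj _ s); split; first by move=> /PP'.
rewrite -[b]quot_reprK !quot_extension_proj -rmorphM -rmorphB.
exact/corresponds_ext_ideal.
Qed.

End Corresponding.

(** The fraction [(i b) / i] represents [b]. *)
Lemma fractional_fiber_outside (P : spec A) (i : A) :
  common_sub I i -> ~ P i -> fractional_fiber e P.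
Proof.
move=> Ii nPi b; have [a aE] := common_mulP b Ii.
by exists a, i; split=> //; rewrite aE subrr; apply: ideal0.
Qed.

Lemma strong_PSI_quot_extension :
  strong_PSI_extension e <-> strong_PSI_extension (quot_extension I).
Proof.
rewrite !strong_PSI_extensionP; split=> h P.
  have PP' := corresponds_preim P.
  pose Q := Spec ((corresponds_prime PP').1 (spec_prime P)).
  move=> /(@fiber_nonzero_quot Q P PP') nz.
  by apply/(@fractional_fiber_quot Q P PP')/h.
move=> nz.
have [sIP|] := pselect (forall i, common_sub I i -> P i); last first.
  move=> /existsNP[i /not_implyP[Ii nPi]].
  exact: fractional_fiber_outside nPi.
have PP' := corresponds_quot sIP.
pose Q := Spec ((corresponds_prime PP').2 (spec_prime P)).
apply/(@fractional_fiber_quot P Q PP')/h.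
exact/(@fiber_nonzero_quot P Q PP').
Qed.

End QuotientFibers.

Theorem proposition3p19 (A B : comPzRingType) (e : ring_extension A B)
    (I : common_ideal e) :
  (PSI_extension e <-> PSI_extension (quot_extension I)) /\
  (strong_PSI_extension e <-> strong_PSI_extension (quot_extension I)).
Proof.
split; first exact: PSI_quot_extension.
exact: strong_PSI_quot_extension.
Qed.
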